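(* Let $m\in\mathbb{N}$, $q=3^{2m+1}$ and $U={}^2G_2^{syl}(q)$. Every $U$-orbit module $\mathbb{C}\mathcal{O}_U([A])$ ($A\in V$) is one of the following orbit modules of verge patterns: \begin{itemize} \item family $\mathfrak{F}_4$: $\mathbb{C}\mathcal{O}_U([A_{14}^*e_{14}])$ with $A_{14}^*\in\mathbb{F}_q^*$, of dimension $q^2$, not irreducible; \item family $\mathfrak{F}_3$: $\mathbb{C}\mathcal{O}_U([A_{13}^*e_{13}])$ with $A_{13}^*\in\mathbb{F}_q^*$, of dimension $q$, not irreducible; \item family $\mathfrak{F}_1$: $\mathbb{C}\mathcal{O}_U([A_{12}e_{12}])$ with $A_{12}\in\mathbb{F}_q$, of dimension $1$, irreducible. \end{itemize} Moreover: (1) If $A,B\in V$ and $\mathrm{verge}(A)\ne\mathrm{verge}(B)$, then $\mathrm{Hom}_{\mathbb{C}U}(\mathbb{C}\mathcal{O}_U([A]),\mathbb{C}\mathcal{O}_U([B]))=\{0\}$. In particular, if $\mathbb{C}\mathcal{O}_U([A])\in\mathfrak{F}_i$, $\mathbb{C}\mathcal{O}_U([B])\in\mathfrak{F}_j$ and $i\ne j$, then $\mathrm{Hom}_{\mathbb{C}U}(\mathbb{C}\mathcal{O}_U([A]),\mathbb{C}\mathcal{O}_U([B]))=\{0\}$. (2) In the family $\mathfrak{F}_1$, the $U$-orbit modules are irreducible and pairwise orthogonal. (3) In the families $\mathfrak{F}_3$ and $\mathfrak{F}_4$, the $U$-orbit modules are reducible.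
   Context: Let $m\in\mathbb{N}=\{0,1,2,\dots\}$, $q=3^{2m+1}$, $\theta=3^m$; $\mathbb{F}_q^*=\mathbb{F}_q\setminus\{0\}$; $e_{ij}=e_{i,j}$ are the $8\times8$ matrix units over $\mathbb{F}_q$. Put $E_1=(e_{1,2}-e_{7,8})+(e_{3,4}-e_{5,6})+(e_{3,5}-e_{4,6})$, $E_2=e_{2,3}-e_{6,7}$, $E_3=-(e_{1,3}-e_{6,8})+(e_{2,4}-e_{5,7})+(e_{2,5}-e_{4,7})$, $E_4=-(e_{1,4}-e_{5,8})-(e_{2,6}-e_{3,7})-(e_{1,5}-e_{4,8})$, $E_5=-(e_{1,6}-e_{3,8})$, $E_6=-(e_{1,7}-e_{2,8})$, and $y_i(t)=I_8+tE_i+\tfrac12t^2E_i^2$. For $t_1,t_3,t_4\in\mathbb{F}_q$ set $Y(t_1,t_3,t_4)=y_2(t_1^{3\theta})y_1(t_1)y_3(t_3)y_4(t_4)y_5(t_3^{3\theta}+t_1^{3\theta+3})y_6(t_4^{3\theta}+t_1^{6\theta+3})$; $U={}^2G_2^{syl}(q)=\{Y(t_1,t_3,t_4): t_i\in\mathbb{F}_q\}$ is a group of order $q^3$ (a Sylow $3$-subgroup of the Ree group ${}^2G_2(q)$). $V=\mathbb{F}_qe_{12}\oplus\mathbb{F}_qe_{13}\oplus\mathbb{F}_qe_{14}$ (its elements are called patterns); $\pi(B)=B_{12}e_{12}+B_{13}e_{13}+B_{14}e_{14}$; $\kappa(A,B)=\mathrm{tr}(A^\top B)$; $\vartheta:\mathbb{F}_q^+\to\mathbb{C}^*$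 is a fixed nontrivial linear character. For $A\in V$, $u\in U$: $\chi_A(u)=\vartheta(\kappa(A,\pi(u)))$, $A.u=\pi(Au^{-\top})$, $[A]=\frac1{|U|}\sum_{u\in U}\overline{\chi_A(u)}\,u\in\mathbb{C}U$. The $[A]$ form a basis of $\mathbb{C}U$ and $[A]u=\chi_{A.u}(u)[A.u]$ under right multiplication. The $U$-orbit module of $A$ is the right $\mathbb{C}U$-module $\mathbb{C}\mathcal{O}_U([A])=\mathbb{C}\text{-span}\{[A.u]:u\in U\}$. The verge of $A\in V$, $\mathrm{verge}(A)$, is $A_{1j}e_{1j}$ where $A_{1j}$ is the rightmost nonzero entry of the first row of $A$ (and $0$ if $A=0$); $A$ is a verge pattern if $A=\mathrm{verge}(A)$. Families: $\mathfrak{F}_4=\{\mathbb{C}\mathcal{O}_U([A]):A_{14}\ne0\}$, $\mathfrak{F}_3=\{\mathbb{C}\mathcal{O}_U([A]):A_{13}\ne0,A_{14}=0\}$, $\mathfrak{F}_1=\{\mathbb{C}\mathcal{O}_U([A]):A_{13}=A_{14}=0\}$. Two $\mathbb{C}U$-modules are orthogonal if there is no nonzero $\mathbb{C}U$-homomorphism between them. *)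

(* Defs.v *)
From mathcomp Require Import all_boot all_order all_fingroup all_algebra.
From mathcomp Require Import all_field mxrepresentation.
From mathcomp Require Import reals.
From mathcomp.real_closed Require Import complex.
From mathcomp Require Import ring.
From Stdlib Require PArith Ring_polynom Ring_theory InitialRing BinList.

Set Implicit Arguments.
Unset Strict Implicit.
Unset Printing Implicit Defensive.

Import GRing.Theory Num.Theory.
Local Open Scope ring_scope.

(* The mathematical indices run from 1 to 8, those of 'I_8 from 0 to 7. *)
Definition mx_e (F : fieldType) (i j : nat) : 'M[F]_8 :=
  delta_mx (inord i.-1) (inord j.-1).

Definition entry (F : fieldType) (A : 'M[F]_8) (i j : nat) : F :=
  A (inord i.-1) (inord j.-1).

Section Generators.
Variable F : fieldType.
Local Notation e := (mx_e F).

Definition gen_E1 : 'M[F]_8 :=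
  (e 1 2 - e 7 8) + (e 3 4 - e 5 6) + (e 3 5 - e 4 6).
Definition gen_E2 : 'M[F]_8 := e 2 3 - e 6 7.
Definition gen_E3 : 'M[F]_8 :=
  - (e 1 3 - e 6 8) + (e 2 4 - e 5 7) + (e 2 5 - e 4 7).
Definition gen_E4 : 'M[F]_8 :=
  - (e 1 4 - e 5 8) - (e 2 6 - e 3 7) - (e 1 5 - e 4 8).
Definition gen_E5 : 'M[F]_8 := - (e 1 6 - e 3 8).
Definition gen_E6 : 'M[F]_8 := - (e 1 7 - e 2 8).

Definition gen_y (E : 'M[F]_8) (t : F) : 'M[F]_8 :=
  1%:M + t *: E + (2^-1 * t ^+ 2) *: (E *m E).

Definition ree_Y (m : nat) (t1 t3 t4 : F) : 'M[F]_8 :=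
  let theta := (3 ^ m)%N in
  gen_y gen_E2 (t1 ^+ (3 * theta)) *m gen_y gen_E1 t1
  *m gen_y gen_E3 t3 *m gen_y gen_E4 t4
  *m gen_y gen_E5 (t3 ^+ (3 * theta) + t1 ^+ (3 * theta + 3))
  *m gen_y gen_E6 (t4 ^+ (3 * theta) + t1 ^+ (6 * theta + 3)).

End Generators.

Arguments ree_Y {F} m t1 t3 t4.

(* Computation with symbolic 8 x 8 matrices, whose entries are polynomial
   expressions normalised modulo 3 by the engine of the ring tactic: it checks
   the product formula gY_mul, from which U is a group. *)
Module Import Sym.
Import Ring_polynom Ring_theory InitialRing.

Section Eval.
Variables (F : fieldType) (h3 : 3%:R = 0 :> F).

Definition c_add x y := ((x + y) %% 3)%N.
Definition c_mul x y := ((x * y) %% 3)%N.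
Definition c_opp x := ((x.*2) %% 3)%N.
Definition c_sub x y := c_add x (c_opp y).

Lemma natr_mod3 n : (n %% 3)%:R = n%:R :> F.
Proof. by rewrite [in RHS](divn_eq n 3) natrD natrM h3 mulr0 add0r. Qed.

Lemma c_morph : ring_morph 0 1 +%R *%R (fun x y : F => x - y) -%R eq
  0%N 1%N c_add c_mul c_sub c_opp eq_op (fun n => n%:R).
Proof.
have oppE n : (c_opp n)%:R = - n%:R :> F.
  by apply/eqP; rewrite natr_mod3 -muln2 -addr_eq0 -natrD -mulnSr natrM h3 mulr0.
split=> // x y; rewrite /c_sub /c_add /c_mul ?natr_mod3 ?natrD ?natrM ?oppE //.
by move/eqP->.
Qed.

Lemma F_ring : ring_theory 0 1 +%R *%R (fun x y : F => x - y) -%R eq.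
Proof.
exact: mk_rt (@add0r F) (@addrC F) (@addrA F) (@mul1r F) (@mulrC F) (@mulrA F)
  (@mulrDl F) (fun _ _ => erefl) (@subrr F).
Qed.

Let Fs := Eqsth F.
Let Fe := Eq_ext (+%R : F -> F -> F) *%R -%R.
Let Fr := Rth_ARth Fs Fe F_ring.

Definition px := PExpr nat.
Definition ev (l : seq F) : px -> F :=
  PEeval 0 1 +%R *%R (fun x y : F => x - y) -%R (fun n => n%:R)
    id_phi_N (pow_N 1 *%R) l.

Definition pnorm (p : px) := norm_subst 0%N 1%N c_add c_mul c_sub c_opp eq_op
  (triv_div 0%N 1%N eq_op) 0 [::] p.

Lemma ev_norm l p q : Peq eq_op (pnorm p) (pnorm q) -> ev l p = ev l q.
Proof.
by move=> h; apply: (ring_correct Fs Fe Fr c_morph (pow_N_th _ _ Fs)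
  (triv_div_th Fs Fe Fr c_morph) 0 l [::]).
Qed.

Definition sadd (p q : px) : px :=
  match p, q with PEO, _ => q | _, PEO => p | _, _ => PEadd p q end.
Definition smul (p q : px) : px :=
  match p, q with
  | PEO, _ | _, PEO => PEO | PEI, _ => q | _, PEI => p | _, _ => PEmul p q
  end.
Definition sopp (p : px) : px := match p with PEO => PEO | _ => PEopp p end.

Variable l : seq F.
Lemma ev_add p q : ev l (sadd p q) = ev l p + ev l q.
Proof. by case: p q => [||?|?|??|??|??|?|??] [||?|?|??|??|??|?|??] //=; rewrite ?add0r ?addr0. Qed.
Lemma ev_mul p q : ev l (smul p q) = ev l p * ev l q.
Proof. by case: p q => [||?|?|??|??|??|?|??] [||?|?|??|??|??|?|??] //=; rewrite ?mul0r ?mulr0 ?mul1r ?mulr1. Qed.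
Lemma ev_opp p : ev l (sopp p) = - ev l p.
Proof. by case: p => //=; rewrite oppr0. Qed.

Definition smx := seq (seq px).
Definition ent (M : smx) i j : px := nth PEO (nth [::] M i) j.
Definition tab (f : nat -> nat -> px) : smx :=
  [seq [seq f i j | j <- iota 0 8] | i <- iota 0 8].
Definition mev (M : smx) : 'M[F]_8 := \matrix_(i, j) ev l (ent M i j).

Lemma mev_tab (f : nat -> nat -> px) (A : 'M[F]_8) :
  (forall i j : 'I_8, A i j = ev l (f i j)) -> mev (tab f) = A.
Proof.
move=> eqA; apply/matrixP=> i j; rewrite eqA mxE /ent /tab.
by rewrite (nth_map 0%N) ?size_iota // (nth_map 0%N) ?size_iota // !nth_iota.
Qed.

Definition me i j := tab (fun r c => if (r.+1 == i) && (c.+1 == j) then PEI else PEO).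
Definition m1 := tab (fun i j => if i == j then PEI else PEO).
Definition madd M N := tab (fun i j => sadd (ent M i j) (ent N i j)).
Definition mopp M := tab (fun i j => sopp (ent M i j)).
Definition mscale a M := tab (fun i j => smul a (ent M i j)).
Definition mmul M N := tab (fun i j =>
  foldr (fun k => sadd (smul (ent M i k) (ent N k j))) PEO (iota 0 8)).

Lemma mev_e i j : (0 < i <= 8)%N -> (0 < j <= 8)%N -> mev (me i j) = mx_e F i j.
Proof.
case: i j => [|i] [|j] //= hi hj; apply: mev_tab => r c.
by rewrite mxE -!val_eqE /= !inordK // !eqSS; case: andP.
Qed.
Lemma mev_1 : mev m1 = 1%:M.
Proof. by apply: mev_tab => i j; rewrite mxE -val_eqE; case: eqP. Qed.
Lemma mev_add M N : mev (madd M N) = mev M + mev N.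
Proof. by apply: mev_tab => i j; rewrite !mxE ev_add. Qed.
Lemma mev_opp M : mev (mopp M) = - mev M.
Proof. by apply: mev_tab => i j; rewrite !mxE ev_opp. Qed.
Lemma mev_scale a M : mev (mscale a M) = ev l a *: mev M.
Proof. by apply: mev_tab => i j; rewrite !mxE ev_mul. Qed.
Lemma mev_mul M N : mev (mmul M N) = mev M *m mev N.
Proof.
apply: mev_tab => i j; rewrite !mxE !big_ord_recl big_ord0 !mxE /= !ev_add.
by rewrite !ev_mul.
Qed.

Local Opaque me m1 madd mopp mscale mmul.

Lemma mev_eq M N :
  all (fun i => all (fun j => Peq eq_op (pnorm (ent M i j)) (pnorm (ent N i j)))
                    (iota 0 8)) (iota 0 8) -> mev M = mev N.
Proof.
move=> /allP h; apply/matrixP=> i j; rewrite !mxE; apply: ev_norm.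
have in8 (k : 'I_8) : val k \in iota 0 8 by rewrite mem_iota /=.
exact: (allP (h _ (in8 i)) _ (in8 j)).
Qed.

Definition my E t := madd (madd m1 (mscale t E)) (mscale (sopp (smul t t)) (mmul E E)).
Definition mE1 := madd (madd (madd (me 1 2) (mopp (me 7 8))) (madd (me 3 4) (mopp (me 5 6))))
   (madd (me 3 5) (mopp (me 4 6))).
Definition mE2 := madd (me 2 3) (mopp (me 6 7)).
Definition mE3 := madd (madd (mopp (madd (me 1 3) (mopp (me 6 8)))) (madd (me 2 4) (mopp (me 5 7))))
   (madd (me 2 5) (mopp (me 4 7))).
Definition mE4 := madd (madd (mopp (madd (me 1 4) (mopp (me 5 8))))
  (mopp (madd (me 2 6) (mopp (me 3 7))))) (mopp (madd (me 1 5) (mopp (me 4 8)))).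
Definition mE5 := mopp (madd (me 1 6) (mopp (me 3 8))).
Definition mE6 := mopp (madd (me 1 7) (mopp (me 2 8))).

Lemma inv2 : 2^-1 = -1 :> F.
Proof.
have e4 : -1 * 2%:R = 1 :> F.
  by apply/eqP; rewrite mulN1r -subr_eq0 -opprD -(natrD _ 2 1) h3 oppr0.
have n0 : 2%:R != 0 :> F.
  by apply/eqP=> z; move/eqP: e4; rewrite z mulr0 eq_sym oner_eq0.
by apply: (mulIf n0); rewrite e4 mulVf.
Qed.

Lemma mev_y E t : mev (my E t) = gen_y (mev E) (ev l t).
Proof. by rewrite !(mev_add, mev_scale, mev_mul, mev_1, ev_opp, ev_mul) /gen_y inv2 mulN1r. Qed.

Lemma mevE : (mev mE1 = gen_E1 F) * (mev mE2 = gen_E2 F) * (mev mE3 = gen_E3 F) *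
  (mev mE4 = gen_E4 F) * (mev mE5 = gen_E5 F) * (mev mE6 = gen_E6 F).
Proof. by do !split; rewrite !(mev_add, mev_opp) !mev_e. Qed.
End Eval.
Local Opaque me m1 madd mopp mscale mmul my mE1 mE2 mE3 mE4 mE5 mE6 sadd smul sopp.


Definition sY a A c C d D : smx :=
  mmul (mmul (mmul (mmul (mmul (my mE2 A) (my mE1 a)) (my mE3 c)) (my mE4 d))
    (my mE5 (sadd C (smul (smul a (smul a a)) A))))
    (my mE6 (sadd D (smul (smul a (smul a a)) (smul A A)))).
Definition gY (F : fieldType) (a A c C d D : F) :=
  gen_y (gen_E2 F) A *m gen_y (gen_E1 F) a *m gen_y (gen_E3 F) c *m gen_y (gen_E4 F) d
    *m gen_y (gen_E5 F) (C + a ^+ 3 * A)  *m gen_y (gen_E6 F) (D + a ^+ 3 * A ^+ 2).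

Lemma gYE (F : fieldType) (a A c C d D : F) : gY a A c C d D =
  gen_y (gen_E2 F) A *m gen_y (gen_E1 F) a *m gen_y (gen_E3 F) c
  *m gen_y (gen_E4 F) d *m gen_y (gen_E5 F) (C + a ^+ 3 * A)
  *m gen_y (gen_E6 F) (D + a ^+ 3 * A ^+ 2).
Proof. by []. Qed.

Lemma mev_Y (F : fieldType) (h3 : 3%:R = 0 :> F) l a A c C d D :
  mev l (sY a A c C d D) = @gY F (ev l a) (ev l A) (ev l c) (ev l C) (ev l d) (ev l D).
Proof.
rewrite !mev_mul. rewrite !(mev_y h3). rewrite !mevE. rewrite !ev_add. rewrite !ev_mul /gY.
by rewrite !(exprS _ 2) !expr2.
Qed.

Local Opaque sY.
Lemma gY_mul (F : fieldType) (h3 : 3%:R = 0 :> F) (a A c C d D x X z Z w W : F) :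
  gY a A c C d D *m gY x X z Z w W =
  gY (a + x) (A + X) (c + z - a * X) (C + Z - A * x ^+ 3)
     (d + w - a ^+ 2 * X + a * x * X - c * x)
     (D + W - A ^+ 2 * x ^+ 3 + A * X * x ^+ 3 - C * X).
Proof.
pose l := [:: a; A; c; C; d; D; x; X; z; Z; w; W].
pose v n : px := PEX nat (BinPos.Pos.of_nat n).
pose sq p : px := PEmul p p; pose cb p : px := PEmul p (sq p).
have := @mev_eq F h3 l
  (mmul (sY (v 1) (v 2) (v 3) (v 4) (v 5) (v 6))
        (sY (v 7) (v 8) (v 9) (v 10) (v 11) (v 12)))
  (sY (PEadd (v 1) (v 7)) (PEadd (v 2) (v 8))
     (PEsub (PEadd (v 3) (v 9)) (PEmul (v 1) (v 8)))
     (PEsub (PEadd (v 4) (v 10)) (PEmul (v 2) (cb (v 7))))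
     (PEsub (PEadd (PEsub (PEadd (v 5) (v 11)) (PEmul (sq (v 1)) (v 8)))
       (PEmul (PEmul (v 1) (v 7)) (v 8))) (PEmul (v 3) (v 7)))
     (PEsub (PEadd (PEsub (PEadd (v 6) (v 12)) (PEmul (sq (v 2)) (cb (v 7))))
       (PEmul (PEmul (v 2) (v 8)) (cb (v 7)))) (PEmul (v 4) (v 8))))%N.
rewrite mev_mul. rewrite !(mev_Y h3). move=> h. have := h ltac:(by vm_compute).
rewrite !(exprS _ 2) !expr2. move=> h2. exact: h2.
Qed.

Lemma gY0 (F : fieldType) : @gY F 0 0 0 0 0 0 = 1%:M.
Proof.
have y0 E : gen_y E (0 : F) = 1%:M.
  by rewrite /gen_y expr0n mulr0 !scale0r !addr0.
by rewrite /gY !expr0n !mulr0 addr0 !y0 !mulmx1.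
Qed.

Lemma eq_gY (F : fieldType) (a b A B c d C D x y X Y : F) :
  a = b -> A = B -> c = d -> C = D -> x = y -> X = Y ->
  gY a A c C x X = gY b B d D y Y.
Proof. by do 6 ! move->. Qed.

Local Opaque gY.

Lemma gY_unit (F : fieldType) (h3 : 3%:R = 0 :> F) (a A c C d D : F) :
  gY a A c C d D \in unitmx.
Proof.
have /mulmx1_unit[] // : gY a A c C d D *m gY (- a) (- A) (- c - a * A)
    (- C - A * a ^+ 3) (- d - a ^+ 2 * A - a * a * A - c * a)
    (- D - A ^+ 2 * a ^+ 3 - A * A * a ^+ 3 - C * A) = 1%:M.
by rewrite (gY_mul h3) -(gY0 F); apply: eq_gY; ring.
Qed.
End Sym.


Section ReeSylow.
Variables (m : nat) (F : finFieldType).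

Definition ree_syl_set : {set {'GL_8[F]}} :=
  [set u : {'GL_8[F]} | [exists t : F * F * F,
     GLval u == ree_Y m t.1.1 t.1.2 t.2]].

Hypothesis cardF : #|F| = (3 ^ (2 * m + 1))%N.
Local Notation sigma t := (t ^+ (3 * 3 ^ m)).

Let pchar3 : 3%N \in [pchar F].
Proof. by apply: card_finPcharP cardF _. Qed.

Let h3 : 3%:R = 0 :> F.
Proof. exact: pcharf0 pchar3. Qed.

Let YE (t1 t3 t4 : F) : ree_Y m t1 t3 t4 =
  gY t1 (sigma t1) t3 (sigma t3) t4 (sigma t4).
Proof.
have e6 : (6 * 3 ^ m = 3 * 3 ^ m * 2)%N by rewrite mulnAC.
rewrite /ree_Y gYE e6 !(exprD t1 _ 3) (exprM t1 (3 * 3 ^ m) 2).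
by rewrite [_ * t1 ^+ 3]mulrC [_ ^+ 2 * t1 ^+ 3]mulrC.
Qed.

Let sigmaD : {morph (fun t : F => sigma t) : x y / x + y}.
Proof.
move=> x y; apply: exprDn_pchar.
by rewrite -expnS (eq_pnat _ (pcharf_eq pchar3)) pnatX.
Qed.

Let sigma0 : sigma (0 : F) = 0.
Proof. by rewrite expr0n muln_eq0 expn_eq0. Qed.

Let sigmaN : {morph (fun t : F => sigma t) : x / - x}.
Proof. by move=> x; apply/eqP; rewrite -addr_eq0 -sigmaD addNr sigma0. Qed.

Let sigmaM : {morph (fun t : F => sigma t) : x y / x * y}.
Proof. by move=> x y; apply: exprMn_comm; apply: mulrC. Qed.

Let sigma2 (t : F) : sigma (sigma t) = t ^+ 3.
Proof.
have e2 : (3 * 3 ^ m * (3 * 3 ^ m) = 3 ^ (2 * m + 1) * 3)%N.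
  by rewrite -!expnS -expnD -expnSr addn1 mul2n -addnn addSn addnS.
by rewrite -exprM e2 -cardF exprM expf_card.
Qed.

Lemma ree_Y_unit (t1 t3 t4 : F) : ree_Y m t1 t3 t4 \in unitmx.
Proof. by rewrite YE gY_unit. Qed.

Lemma ree_Y_mul (a c d x z w : F) :
  ree_Y m a c d *m ree_Y m x z w =
  ree_Y m (a + x) (c + z - a * sigma x)
    (d + w - a ^+ 2 * sigma x + a * x * sigma x - c * x).
Proof.
rewrite !YE (gY_mul h3).
rewrite !expr2 !(sigmaD, sigmaN, sigmaM) !sigma2.
by apply: eq_gY; ring.
Qed.

Lemma ree_syl_group_set : group_set ree_syl_set.
Proof.
apply/group_setP; split=> [|u v]; rewrite !inE.
  by apply/existsP; exists (0, 0, 0); rewrite /= YE !sigma0 gY0.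
move=> /existsP[[[a c] d] /= /eqP eu] /existsP[[[x z] w] /= /eqP ev].
apply/existsP; exists (a + x, c + z - a * sigma x,
  d + w - a ^+ 2 * sigma x + a * x * sigma x - c * x) => /=.
by rewrite -ree_Y_mul -eu -ev.
Qed.

Definition ree_syl : {group {'GL_8[F]}} := Group ree_syl_group_set.

End ReeSylow.

Section Patterns.
Variable F : fieldType.

Definition patterns : {vspace 'M[F]_8} :=
  (<[mx_e F 1 2]> + <[mx_e F 1 3]> + <[mx_e F 1 4]>)%VS.

Definition pattern_proj (B : 'M[F]_8) : 'M[F]_8 :=
  entry B 1 2 *: mx_e F 1 2 + entry B 1 3 *: mx_e F 1 3
  + entry B 1 4 *: mx_e F 1 4.

Definition kappa (A B : 'M[F]_8) : F := \tr (A^T *m B).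

Definition verge (A : 'M[F]_8) : 'M[F]_8 :=
  if [pick j | (A 0 j != 0) && [forall k : 'I_8, (j < k)%N ==> (A 0 k == 0)]]
    is Some j then A 0 j *: delta_mx 0 j else 0.

Definition verge_pattern (A : 'M[F]_8) : Prop :=
  A \in patterns /\ A = verge A.

(* A.u = pi (A u^-T) *)
Definition pattern_act (A u : 'M[F]_8) : 'M[F]_8 :=
  pattern_proj (A *m (invmx u)^T).

End Patterns.

Definition linear_character (F : fieldType) (C : fieldType) (th : F -> C) :=
  th 0 = 1 /\ {morph th : x y / x + y >-> x * y}.

(* The group algebra CU is 'rV[C]_#|U|: the group element u is the basis vector
   of index gring_index U u, and right multiplication by u is *m regular_mx u.
   Its submodules are row spaces of matrices. *)
Section OrbitModules.
Variables (C : numClosedFieldType) (F : finFieldType) (U : {group {'GL_8[F]}}).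
Variable th : F -> C.

Definition group_elt (u : {'GL_8[F]}) : 'rV[C]_#|U| :=
  delta_mx 0 (gring_index U u).

Definition chi (A : 'M[F]_8) (u : {'GL_8[F]}) : C :=
  th (kappa A (pattern_proj (GLval u))).

Definition bracket (A : 'M[F]_8) : 'rV[C]_#|U| :=
  #|U|%:R^-1 *: \sum_(u in U) (chi A u)^* *: group_elt u.

(* A sum of row spaces is in canonical form, so that equality of these matrices
   is equality of the subspaces. *)
Definition orbit_module (A : 'M[F]_8) : 'M[C]_#|U| :=
  (\sum_(u in U) <<bracket (pattern_act A (GLval u))>>)%MS.

Definition in_family (i : nat) (M : 'M[C]_#|U|) : Prop :=
  exists A : 'M[F]_8, [/\ A \in patterns F, M = orbit_module A &
    match i with
    | 4 => entry A 1 4 != 0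
    | 3 => entry A 1 3 != 0 /\ entry A 1 4 = 0
    | 1 => entry A 1 3 = 0 /\ entry A 1 4 = 0
    | _ => False
    end].

End OrbitModules.

(* Every linear map between submodules extends to the whole space, so a matrix f
   stands for an arbitrary homomorphism from M to N. *)
Definition hom_trivial (C : fieldType) (gT : finGroupType) (G : {group gT})
    (n : nat) (rG : mx_representation C G n) (M N : 'M[C]_n) : Prop :=
  forall f : 'M[C]_n,
    (M <= dom_hom_mx rG f)%MS -> (M *m f <= N)%MS -> M *m f = 0.

Definition orthogonal_modules (C : fieldType) (gT : finGroupType)
    (G : {group gT}) (n : nat) (rG : mx_representation C G n)
    (M N : 'M[C]_n) : Prop :=
  hom_trivial rG M N /\ hom_trivial rG N M.

(* Main.v *)
(* In the coordinates (a, - c, a c - d) of pi (Y (a, c, d)), the group U acts on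
   the pattern (x, y, z) by
     (x, y, z).Y(a, c, d) = (x - y a^(3 theta) - z c, y - z a, z),
   so the orbit of (x, y, z) consists of all (x', y', z) if z != 0, of all
   (x', y, 0) if z = 0 and y != 0, and of (x, 0, 0) alone if y = z = 0.  By
   orthogonality of characters the [A] are linearly independent, so the
   dimension of an orbit module is the size of the orbit.  Modules with distinct
   verges are separated by scalars: Y(0, 0, d) acts on an orbit module by
   th (- z d), Y(0, c, d) by th (- y c) if z = 0, and Y(a, 0, 0) by th (x a) if
   y = z = 0.  Reducibility is Burnside's theorem: an irreducible module of
   dimension n has n ^ 2 independent operators, whereas U yields at most q ^ 3 on
   a module of dimension q ^ 2, and at most q on one of dimension q of the family
   F_3, where the elements Y(0, c, d) are scalars. *)
Require Import Defs.
From mathcomp Require Import all_boot all_order all_fingroup all_algebra.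
From mathcomp Require Import all_field mxrepresentation.
From mathcomp Require Import reals.
From mathcomp.real_closed Require Import complex.
From mathcomp Require Import ring.
From mathcomp Require boolp.
From Stdlib Require Ring_polynom BinPos.

Set Implicit Arguments.
Unset Strict Implicit.
Unset Printing Implicit Defensive.

Import GRing.Theory Num.Theory.
Local Open Scope ring_scope.

(** * The upper left 4 x 4 block of Y(a, c, d) *)

Section ReeMatrices.
Variables (m : nat) (F : finFieldType).
Hypothesis cardF : #|F| = (3 ^ (2 * m + 1))%N.
Local Notation sigma t := (t ^+ (3 * 3 ^ m)).

Lemma ree_natr3 : 3%:R = 0 :> F.
Proof. by apply: pcharf0; apply: card_finPcharP cardF _. Qed.

(** This block is all that patterns see: pi reads columns 2 to 4 of its first row, and the action A
    u^-T reads rows and columns 2 to 4. *)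
Lemma ree_Y_upper_block (a c d : F) (i j : nat) : (0 < i <= 4)%N -> (0 < j <= 4)%N ->
  entry (ree_Y m a c d) i j =
  nth 0 (nth [::] [:: [:: 1; a; - c; a * c - d]; [:: 0; 1; sigma a; a * sigma a + c];
                      [:: 0; 0; 1; a]; [:: 0; 0; 0; 1]] i.-1) j.-1.
Proof.
have e6 : (6 * 3 ^ m = 3 * 3 ^ m * 2)%N by rewrite mulnAC.
have -> : ree_Y m a c d = Sym.gY a (sigma a) c (sigma c) d (sigma d).
  rewrite /ree_Y Sym.gYE e6 !(exprD a _ 3) (exprM a (3 * 3 ^ m) 2).
  by rewrite [_ * a ^+ 3]mulrC [_ ^+ 2 * a ^+ 3]mulrC.
pose v n : Sym.px := Ring_polynom.PEX nat (BinPos.Pos.of_nat n).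
pose E0 : Sym.px := @Ring_polynom.PEO nat; pose E1 : Sym.px := @Ring_polynom.PEI nat.
pose T : seq (seq Sym.px) :=
  [:: [:: E1; v 1; Ring_polynom.PEopp (v 3);
          Ring_polynom.PEsub (Ring_polynom.PEmul (v 1) (v 3)) (v 5)];
      [:: E0; E1; v 2;
          Ring_polynom.PEadd (Ring_polynom.PEmul (v 1) (v 2)) (v 3)];
      [:: E0; E0; E1; v 1]; [:: E0; E0; E0; E1]]%N.
pose l := [:: a; sigma a; c; sigma c; d; sigma d].
(* The entries are compared as polynomials modulo 3, with a, c, d and their images under [sigma] as
   six independent variables. *)
have hT i' j' : (i' < 4)%N -> (j' < 4)%N ->
  Ring_polynom.Peq eq_op
    (Sym.pnorm (Sym.ent (Sym.sY (v 1) (v 2) (v 3) (v 4) (v 5) (v 6)) i' j'))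
    (Sym.pnorm (Sym.ent T i' j')).
  by case: i' => [|[|[|[|]]]] //; case: j' => [|[|[|[|]]]] // _ _; vm_compute.
have := Sym.mev_Y ree_natr3 l (v 1) (v 2) (v 3) (v 4) (v 5) (v 6).
move=> <-; case: i => [|i] // /andP[_ hi]; case: j => [|j] // /andP[_ hj].
rewrite /entry mxE !inordK ?(leq_trans hi) ?(leq_trans hj) //.
rewrite (Sym.ev_norm ree_natr3 _ (hT i j hi hj)).
by case: i hi => [|[|[|[|]]]] // _; case: j hj => [|[|[|[|]]]].
Qed.

End ReeMatrices.

(** * Patterns as triples of coordinates *)

Section PatternCoordinates.
Variable F : fieldType.
Implicit Types (A B : 'M[F]_8) (p r : F * F * F).

Definition pat p : 'M[F]_8 :=
  p.1.1 *: mx_e F 1 2 + p.1.2 *: mx_e F 1 3 + p.2 *: mx_e F 1 4.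

Definition dot p r : F := p.1.1 * r.1.1 + p.1.2 * r.1.2 + p.2 * r.2.

Lemma entry_mx_e (i j k l : nat) : (0 < i <= 8)%N -> (0 < j <= 8)%N ->
  (0 < k <= 8)%N -> (0 < l <= 8)%N ->
  entry (mx_e F i j) k l = ((k == i) && (l == j))%:R.
Proof.
case: i j k l => [|i] [|j] [|k] [|l] //= hi hj hk hl.
by rewrite /entry mxE -!val_eqE /= !inordK.
Qed.

Lemma entry_pat p (j : nat) : (0 < j <= 8)%N ->
  entry (pat p) 1 j = nth 0 [:: 0; p.1.1; p.1.2; p.2] j.-1.
Proof.
move=> hj; have e k : (0 < k <= 8)%N -> entry (mx_e F 1 k) 1 j = (j == k)%:R.
  by move=> hk; rewrite entry_mx_e.
have -> : entry (pat p) 1 j = p.1.1 * entry (mx_e F 1 2) 1 j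
    + p.1.2 * entry (mx_e F 1 3) 1 j + p.2 * entry (mx_e F 1 4) 1 j.
  by rewrite /entry !mxE.
rewrite !e //; case: j hj {e} => [|[|[|[|[|j]]]]] //= _;
  by rewrite ?(mulr0, mulr1, addr0, add0r) ?nth_nil.
Qed.

Lemma pattern_projE B : pattern_proj B = pat (entry B 1 2, entry B 1 3, entry B 1 4).
Proof. by []. Qed.

Lemma patterns_pat p : pat p \in patterns F.
Proof. by rewrite !memv_add ?memvZ ?memv_line. Qed.

Lemma patternsP A : A \in patterns F -> exists p, A = pat p.
Proof.
case/memv_addP=> B /memv_addP[B1 /vlineP[x ->] [B2 /vlineP[y ->] ->]].
by case=> B3 /vlineP[z ->] ->; exists (x, y, z).
Qed.

Lemma kappa_pat p r : kappa (pat p) (pat r) = dot p r.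
Proof.
have kE A i j : kappa A (mx_e F i j) = entry A i j.
  rewrite /kappa /mxtrace (bigD1 (inord j.-1)) //= big1 ?addr0 => [|k ne_kj].
    rewrite mxE (bigD1 (inord i.-1)) //= big1 ?addr0 => [|l ne_li].
      by rewrite !mxE !eqxx mulr1.
    by rewrite !mxE (negPf ne_li) mulr0.
  by rewrite mxE big1 // => l _; rewrite !mxE (negPf ne_kj) andbF mulr0.
have -> : kappa (pat p) (pat r) = r.1.1 * kappa (pat p) (mx_e F 1 2)
    + r.1.2 * kappa (pat p) (mx_e F 1 3) + r.2 * kappa (pat p) (mx_e F 1 4).
  by rewrite /kappa {2}/pat !mulmxDr -!scalemxAr !mxtraceD !mxtraceZ.
by rewrite !kE !entry_pat //= /dot; congr (_ + _ + _); rewrite mulrC.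
Qed.

Lemma entry_pat_mul_tr p B (j : nat) : (0 < j <= 8)%N ->
  entry (pat p *m B^T) 1 j =
  p.1.1 * entry B j 2 + p.1.2 * entry B j 3 + p.2 * entry B j 4.
Proof.
have eM k l : entry (mx_e F 1 k *m B^T) 1 l = entry B l k.
  rewrite /entry mxE (bigD1 (inord k.-1)) //= big1 ?addr0 => [|i ne_ik].
    by rewrite !mxE !eqxx mul1r.
  by rewrite !mxE (negPf ne_ik) andbF mul0r.
by move=> _; rewrite -!eM /pat !mulmxDl -!scalemxAl /entry !mxE.
Qed.

Lemma verge_pat p : verge (pat p) =
  if p.2 != 0 then p.2 *: mx_e F 1 4
  else if p.1.2 != 0 then p.1.2 *: mx_e F 1 3 else p.1.1 *: mx_e F 1 2.
Proof.
have o0 : inord 0 = 0 :> 'I_8 by apply: val_inj; rewrite /= inordK.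
have rowE (j : 'I_8) : pat p 0 j = nth 0 [:: 0; p.1.1; p.1.2; p.2] j.
  by have := @entry_pat p j.+1 (ltn_ord j); rewrite /entry /= o0 inord_val.
(* [pick] may return any index satisfying its predicate; a nonzero entry followed only by zeros is
   the unique such index. *)
have vE (k : nat) : (k < 8)%N -> pat p 0 (inord k) != 0 ->
    (forall j : 'I_8, (k < j)%N -> pat p 0 j = 0) ->
    verge (pat p) = pat p 0 (inord k) *: delta_mx (inord 0) (inord k).
  move=> lt_k nz_k z_k; rewrite /verge o0.
  case: pickP => [j /andP[nz_j /forallP z_j]|/(_ (inord k))]; last first.
    rewrite nz_k /= => /negP[]; apply/forallP=> j; apply/implyP.
    by rewrite inordK // => /z_k->.
  have -> // : j = inord k; apply/val_inj; rewrite /= inordK //.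
  case: (ltngtP j k) => // [lt_jk | /z_k zj]; last by rewrite zj eqxx in nz_j.
  by have := z_j (inord k); rewrite inordK // lt_jk /= (negPf nz_k).
have big (j : 'I_8) : (3 < j)%N -> pat p 0 j = 0.
  by move=> lt3; rewrite rowE nth_default.
case: eqP => [z2 | /eqP nz2] /=; last by rewrite (vE 3) ?rowE ?inordK.
have big2 (j : 'I_8) : (2 < j)%N -> pat p 0 j = 0.
  by rewrite leq_eqVlt => /orP[/eqP e|/big //]; rewrite rowE -e.
case: eqP => [z1 | /eqP nz1] /=; last by rewrite (vE 2) ?rowE ?inordK.
have big1_ (j : 'I_8) : (1 < j)%N -> pat p 0 j = 0.
  by rewrite leq_eqVlt => /orP[/eqP e|/big2 //]; rewrite rowE -e.
have [z0|nz0] := eqVneq p.1.1 0; last by rewrite (vE 1) ?rowE ?inordK.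
(* For the zero pattern [pick] finds nothing, and the default 0 agrees with the last branch, whose
   coefficient is 0. *)
rewrite z0 scale0r /verge; case: pickP => // j /andP[].
by rewrite rowE; case: (nat_of_ord j) => [|[|[|[|k]]]]; rewrite /= ?z0 ?z1 ?z2 ?eqxx //
  nth_nil eqxx.
Qed.

End PatternCoordinates.

(** * The group law and the action in coordinates *)

Section PatternAction.
Variables (m : nat) (F : finFieldType).
Hypothesis cardF : #|F| = (3 ^ (2 * m + 1))%N.
Local Notation sigma t := (t ^+ (3 * 3 ^ m)).
Local Notation T := (F * F * F)%type.
Implicit Types p t s : T.

Definition Yt t : 'M[F]_8 := ree_Y m t.1.1 t.1.2 t.2.

Definition Ymul t s : T :=
  (t.1.1 + s.1.1, t.1.2 + s.1.2 - t.1.1 * sigma s.1.1,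
   t.2 + s.2 - t.1.1 ^+ 2 * sigma s.1.1 + t.1.1 * s.1.1 * sigma s.1.1 - t.1.2 * s.1.1).

Definition Ycoord t : T := (t.1.1, - t.1.2, t.1.1 * t.1.2 - t.2).

Definition pact p t : T :=
  (p.1.1 - p.1.2 * sigma t.1.1 - p.2 * t.1.2, p.1.2 - p.2 * t.1.1, p.2).

Lemma Yt_mul t s : Yt t *m Yt s = Yt (Ymul t s).
Proof. exact: ree_Y_mul cardF _ _ _ _ _ _. Qed.

Lemma Yt_proj t : pattern_proj (Yt t) = pat (Ycoord t).
Proof. by rewrite pattern_projE /Yt !(ree_Y_upper_block cardF). Qed.

Lemma pattern_act_pat p t : pattern_act (pat p) (Yt t) = pat (pact p t).
Proof.
case: t => [[a c] d].
(* The inverse of Y(a, c, d), found by solving [Ymul t s] = (0, 0, 0) coordinate by coordinate. *)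
pose s : T := (- a, - c - a * sigma a, - d - a ^+ 2 * sigma a - a * a * sigma a - c * a).
have sN x : sigma (- x) = - sigma x :> F.
  by rewrite exprNn -signr_odd oddM oddX orbT expr1 mulN1r.
have Y0 : Yt (0, 0, 0) = 1%:M.
  have y0 E : gen_y E (0 : F) = 1%:M by rewrite /gen_y expr0n mulr0 !scale0r !addr0.
  by rewrite /Yt /ree_Y /= !expr0n !addn_eq0 !expn_eq0 /= addr0 !y0 !mulmx1.
have iY : invmx (Yt (a, c, d)) = Yt s.
  have e1 : Yt (a, c, d) *m Yt s = 1%:M.
    rewrite Yt_mul -Y0; congr Yt; rewrite /Ymul /= !sN.
    by congr (_, _, _); ring.
  have [uY _] := mulmx1_unit e1.
  by rewrite -[LHS]mulmx1 -e1 mulKmx.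
rewrite /pattern_act pattern_projE iY !entry_pat_mul_tr //.
rewrite !(ree_Y_upper_block cardF) //= /pact /= sN.
by congr pat; congr (_, _, _); ring.
Qed.

(** After applying [th], this is chi_{A.s}(t s) = chi_A(t) chi_{A.s}(s), the cocycle identity behind
    the monomial action [A]s = chi_{A.s}(s) [A.s]. *)
Lemma dot_Ymul p t s :
  dot (pact p s) (Ycoord (Ymul t s)) = dot p (Ycoord t) + dot (pact p s) (Ycoord s).
Proof.
have h2 : 2 = -1 :> F.
  by apply/eqP; rewrite -addr_eq0 -(natrD _ 2 1) (ree_natr3 cardF).
case: p t s => [[x y] z] [[a c] d] [[a' c'] d']; rewrite /dot /=.
set S := sigma a'; apply/eqP; rewrite -subr_eq0; apply/eqP.
(* The two sides differ by a multiple of 3, so they agree only because the characteristic is 3. *)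
transitivity (3%:R * z * (a' * c - a * a' * S)); last by rewrite (ree_natr3 cardF) !mul0r.
by ring.
Qed.

End PatternAction.

(** Being canonical, two such sums with the same row space are equal as matrices; [orbit_module_pat]
    rests on this. *)
Lemma genmx_sums_genmx (K : fieldType) (I : finType) (P : pred I) (k n : nat)
    (w : I -> 'M[K]_(k, n)) :
  <<(\sum_(i | P i) <<w i>>)%MS>>%MS = (\sum_(i | P i) <<w i>>)%MS.
Proof.
by rewrite genmx_sums; apply: eq_bigr => i _; apply: genmx_id. Qed.

(** * Criteria for vanishing homomorphisms and for irreducibility *)

Section ModuleTools.
Variables (C : fieldType) (gT : finGroupType) (G : {group gT}) (n : nat).
Variable rG : mx_representation C G n.

(** On the image of f, x acts by a because f commutes with x, and by b because the image lies in
    N. *)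
Lemma hom_trivial_scalar (M N : 'M[C]_n) x a b : x \in G ->
  M *m rG x = a *: M -> N *m rG x = b *: N -> a != b -> hom_trivial rG M N.
Proof.
move=> Gx Ma Nb ne_ab f /hom_mxP/(_ x Gx) homf /submxP[D defD].
have e1 : M *m f *m rG x = a *: (M *m f) by rewrite -homf Ma -scalemxAl.
have e2 : M *m f *m rG x = b *: (M *m f) by rewrite defD -mulmxA Nb -scalemxAr.
apply/eqP; move/eqP: e1; rewrite e2 eq_sym -subr_eq0 -scalerBl scaler_eq0.
by rewrite subr_eq0 (negPf ne_ab).
Qed.

Lemma mxsimple_rank1 (M : 'M[C]_n) :
  mxmodule rG M -> \rank M = 1%N -> mxsimple rG M.
Proof.
move=> modM rM; split=> // [|W _ sWM nzW]; first by rewrite -mxrank_eq0 rM.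
by rewrite -(mxrank_leqif_sup sWM) eqn_leq mxrankS // rM lt0n mxrank_eq0.
Qed.

(* Burnside: over a splitting field the operators of G on M span all of End M. *)
Lemma mxsimple_rank_sqr (I : finType) (S : I -> 'M[C]_n) (M : 'M[C]_n) :
  group_splitting_field C G -> mxsimple rG M ->
  (forall x, x \in G -> exists i, exists c, M *m rG x = c *: (M *m S i)) ->
  (\rank M ^ 2 <= #|I|)%N.
Proof.
move=> splitG simM spanS; have modM := mxsimple_module simM.
have /splitG/andP[_ /eqP fullE] := (submod_mx_irr modM).2 simM.
have /submxP[D defD] : (val_submod (1%:M : 'M_(\rank M)) <= M)%MS by rewrite val_submodP.
(* One row per index i, the compression of [S i] to M. The rows span the enveloping algebra of G on
   M, whose dimension is the square of that of M. *)
pose W : 'M_(#|I|, _) := \matrix_i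
  mxvec (in_submod M (val_submod (1%:M : 'M_(\rank M)) *m S (enum_val i))).
rewrite expnS expn1 -fullE; apply: leq_trans (rank_leq_row W).
apply/mxrankS/row_subP=> j; rewrite rowK /= /submod_mx.
have [i [c eS]] := spanS _ (enum_valP j).
have -> : in_submod M (val_submod (1%:M : 'M_(\rank M)) *m rG (enum_val j))
        = c *: in_submod M (val_submod (1%:M : 'M_(\rank M)) *m S i).
  by rewrite defD -!mulmxA eS -!linearZ /= -scalemxAr.
rewrite linearZ scalemx_sub //; apply: submx_trans (row_sub (enum_rank i) W).
by rewrite rowK enum_rankK.
Qed.

End ModuleTools.

(** * The group U parametrised by triples *)

Section OrbitModules.
Variables (C : numClosedFieldType) (m : nat) (F : finFieldType).
Hypothesis cardF : #|F| = (3 ^ (2 * m + 1))%N.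
Variable th : F -> C.
Hypotheses (th_lin : linear_character th) (th_nontrivial : exists t : F, th t != 1).

Local Notation sigma t := (t ^+ (3 * 3 ^ m)).
Local Notation T := (F * F * F)%type.
Local Notation U := (ree_syl cardF).
Local Notation rU := (regular_repr C U).
Local Notation act := (pact m).
Implicit Types p r t s : T.

Definition elt t : {'GL_8[F]} := FinRing.Unit (ree_Y_unit cardF t.1.1 t.1.2 t.2).

Lemma GLval_elt t : GLval (elt t) = Yt m t.
Proof. by []. Qed.

Lemma ree_sylP u : reflect (exists t, u = elt t) (u \in U).
Proof.
rewrite inE; apply: (iffP existsP) => [[t /eqP ut]|[t ->]]; exists t => //.
exact: val_inj.
Qed.

Lemma elt_in t : elt t \in U.
Proof. by apply/ree_sylP; exists t. Qed.

Lemma eltM t s : (elt t * elt s)%g = elt (Ymul m t s).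
Proof. by apply: val_inj; apply: Yt_mul. Qed.

(** The entries a, - c and a c - d of the first row already determine the triple. *)
Lemma elt_inj : injective elt.
Proof.
move=> [[a c] d] [[a' c'] d'] /(congr1 GLval); rewrite !GLval_elt => eqY.
have eqe i j : entry (Yt m (a, c, d)) i j = entry (Yt m (a', c', d')) i j by rewrite eqY.
move: (eqe 1%N 2%N) (eqe 1%N 3%N) (eqe 1%N 4%N).
rewrite /Yt !(ree_Y_upper_block cardF) //= => <- /oppr_inj<-.
by move=> /addrI/oppr_inj <-.
Qed.

Lemma sum_ree_syl (V : nmodType) (f : {'GL_8[F]} -> V) :
  \sum_(u in U) f u = \sum_t f (elt t).
Proof.
have -> : U = [set elt t | t in [set: T]] :> {set _}.
  apply/setP=> u; apply/ree_sylP/imsetP=> [[t ->]|[t _ ->]]; by exists t.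
rewrite big_imset => [|t s _ _]; last exact: elt_inj.
by apply: eq_bigl => t; rewrite inE.
Qed.

Lemma card_ree_syl : #|U| = (#|F| ^ 3)%N.
Proof.
have := @sum_ree_syl nat (fun=> 1%N); rewrite !sum1_card => ->.
by rewrite !card_prod !expnS muln1 mulnA.
Qed.

(** * The additive character and its sums over U *)

Lemma thD x y : th (x + y) = th x * th y.
Proof. by case: th_lin => _; apply. Qed.

(** Since 3 x = 0, the value [th x] is a cube root of unity, hence of modulus 1. *)
Lemma th_conjK x : th x * (th x)^* = 1.
Proof.
have e3 : th x ^+ 3 = 1.
  rewrite !exprS expr0 mulr1 -!thD; case: th_lin => <- _; congr th.
  by rewrite -[RHS](mul0r x) -(ree_natr3 cardF); ring.
have : `|th x| ^+ 3 == 1 by rewrite -normrX e3 normr1.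
by rewrite pexpr_eq1 // => /eqP n1; rewrite -normCK n1 expr1n.
Qed.

Lemma th_neq0 x : th x != 0.
Proof.
by apply/eqP=> z; move: (th_conjK x); rewrite z mul0r => /esym/eqP; rewrite oner_eq0.
Qed.

Lemma th_conj x : (th x)^* = th (- x).
Proof.
apply: (mulfI (th_neq0 x)); rewrite th_conjK -thD subrr.
by case: th_lin.
Qed.

(** Dividing an element where [th] is not 1 by x - y gives a t for which x t and y t differ by that
    element. *)
Lemma th_separates (x y : F) : x != y -> exists t : F, th (x * t) != th (y * t).
Proof.
rewrite -subr_eq0 => nz; have [t nt] := th_nontrivial.
exists (t / (x - y)); apply: contra nt => /eqP e.
have <- : x * (t / (x - y)) - y * (t / (x - y)) = t by rewrite -mulrBl mulrC divfK.
by rewrite thD e -thD subrr; case: th_lin => ->.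
Qed.

Lemma chi_elt p t : chi th (pat p) (elt t) = th (dot p (Ycoord t)).
Proof. by rewrite /chi GLval_elt (Yt_proj cardF) kappa_pat. Qed.

Lemma sum_th_dot p : p != (0, 0, 0) -> \sum_t th (dot p (Ycoord t)) = 0.
Proof.
move=> nz.
(* A translation h multiplies the sum by [th x], which is not 1, so the sum vanishes. The shift is
   in d if z != 0, else in c if y != 0, else in a: shifts in c or a also change the third coordinate
   a c - d, which is harmless once z = 0. *)
suff [h [x [injh eh nx]]] : exists h : T -> T, exists x : F, [/\ injective h,
    forall t, dot p (Ycoord (h t)) = dot p (Ycoord t) + x & th x != 1].
  have : (1 - th x) * (\sum_t th (dot p (Ycoord t))) = 0.
    rewrite mulrBl mul1r [X in X - _](reindex_inj injh) mulr_sumr -sumrB.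
    by rewrite big1 // => t _; rewrite eh thD mulrC subrr.
  by move/eqP; rewrite mulf_eq0 subr_eq0 eq_sym (negPf nx) => /eqP.
have sep (x : F) : x != 0 -> exists t : F, th (x * t) != 1.
  by case/th_separates=> t; rewrite mul0r; case: th_lin => -> _; exists t.
case: p nz => [[x y] z]; rewrite !xpair_eqE !negb_and.
have [->|nz _] := eqVneq z 0; last first.
  have [w nw] := sep _ nz; exists (fun t => (t.1, t.2 - w)), (z * w).
  split=> // [[[a c] d] [[a' c'] d'] [-> -> /addIr-> //]|[[a c] d]].
  by rewrite /dot /=; ring.
have [->|ny _] := eqVneq y 0; last first.
  have [w nw] := sep _ ny; exists (fun t => (t.1.1, t.1.2 - w, t.2)), (y * w).
  split=> // [[[a c] d] [[a' c'] d'] [-> /addIr-> -> //]|[[a c] d]].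
  by rewrite /dot /=; ring.
rewrite /= !orbF => nx.
have [w nw] := sep _ nx; exists (fun t => (t.1.1 + w, t.1.2, t.2)), (x * w).
split=> // [[[a c] d] [[a' c'] d'] [/addIr-> -> -> //]|[[a c] d]].
by rewrite /dot /=; ring.
Qed.

(** * The elements [A]: monomial action and linear independence *)

Definition br p : 'rV[C]_#|U| := bracket U th (pat p).

(** Reindex the sum defining [A.s] by u -> u s: by [dot_Ymul] its coefficients become those of [A]
    times the conjugate of the scalar, which cancels against the scalar. *)
Lemma br_mul p s :
  br p *m rU (elt s) = th (dot (act p s) (Ycoord s)) *: br (act p s).
Proof.
rewrite /br /bracket -scalemxAl [RHS]scalerA mulrC -scalerA; congr (_ *: _).
rewrite scaler_sumr [in RHS](reindex_inj (mulIg (elt s))) mulmx_suml.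
apply: eq_big => [u|u /ree_sylP[t ->]]; first by rewrite groupMr ?elt_in.
rewrite eltM !chi_elt (dot_Ymul cardF) (thD (dot _ _)) rmorphM.
rewrite scalerA mulrCA th_conjK mulr1.
rewrite -scalemxAl; congr (_ *: _).
by rewrite /group_elt /= -rowE rowK gring_indexK ?elt_in // -eltM.
Qed.

(** Pairing with the character chi_r; orthogonality makes these columns dual to the rows [br p]. *)
Definition dual_br r : 'cV[C]_#|U| := \col_j chi th (pat r) (enum_val j).

Lemma br_dual p r : br p *m dual_br r = (p == r)%:R%:M.
Proof.
rewrite [LHS]mx11_scalar; congr (_%:M).
have -> : (br p *m dual_br r) 0 0
    = #|U|%:R^-1 * \sum_(u in U) (chi th (pat p) u)^* * chi th (pat r) u.
  rewrite /br /bracket -scalemxAl mxE; congr (_ * _).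
  rewrite mulmx_suml summxE; apply: eq_bigr => u Uu.
  by rewrite -scalemxAl mxE -rowE !mxE gring_indexK.
rewrite sum_ree_syl.
pose D : T := (r.1.1 - p.1.1, r.1.2 - p.1.2, r.2 - p.2).
under eq_bigr => t _.
  rewrite !chi_elt th_conj -thD.
  have -> : - dot p (Ycoord t) + dot r (Ycoord t) = dot D (Ycoord t).
    by rewrite /dot /=; ring.
  over.
have [eq_pr|ne_pr] := eqVneq p r.
  under eq_bigr => t _.
    rewrite /dot /D eq_pr /= !subrr !mul0r !addr0; case: th_lin => -> _; over.
  have cT : #|{: T}| = #|U| by rewrite !card_prod card_ree_syl !expnS muln1 mulnA.
  rewrite sumr_const cT mulVf // pnatr_eq0 -lt0n; exact: cardG_gt0.
rewrite sum_th_dot ?mulr0 //; apply: contra ne_pr; rewrite !xpair_eqE !subr_eq0.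
case: p r @D => [[x y] z] [[x' y'] z'] /=.
by case/andP=> /andP[/eqP-> /eqP->] /eqP->.
Qed.

Definition span_br (S : {set T}) : 'M[C]_#|U| := (\sum_(p in S) <<br p>>)%MS.

Lemma rank_span_br S : \rank (span_br S) = #|S|.
Proof.
pose W := \matrix_(i < #|S|) br (enum_val i).
have -> : \rank (span_br S) = \rank W.
  apply/eqP; rewrite eqn_leq !mxrankS //.
    apply/row_subP=> i; rewrite rowK (sumsmx_sup (enum_val i)) ?enum_valP //.
    by rewrite genmxE.
  apply/sumsmx_subP=> p Sp; rewrite genmxE.
  by rewrite -(enum_rankK_in Sp Sp) -[br _](rowK (fun i : 'I_#|S| => br (enum_val i))) row_sub.
(* The dual columns assemble to a right inverse of W. *)
apply/eqP/row_freeP; exists (\matrix_(j, i) dual_br (enum_val i) j 0).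
apply/matrixP=> i j.
have := br_dual (enum_val i) (enum_val j) => /(congr1 (fun A : 'M_1 => A 0 0)).
rewrite !mxE mulr1n (inj_eq enum_val_inj) => <-.
by apply: eq_bigr => k _; rewrite !mxE.
Qed.

(** * Orbits of patterns and their modules *)

Definition orb p : {set T} :=
  [set r | (r.2 == p.2) && ((p.2 != 0) || (r.1.2 == p.1.2) &&
           ((p.1.2 != 0) || (r.1.1 == p.1.1)))].

(** With theta = 3^m one has theta * 3 theta = q, so x^theta is sent to x^q = x. *)
Lemma sigma_surj (x : F) : exists a : F, sigma a = x.
Proof.
have e : (3 ^ m * (3 * 3 ^ m) = #|F|)%N.
  by rewrite cardF mulnCA -expnD addnn -mul2n addn1 expnS.
by exists (x ^+ (3 ^ m)); rewrite -exprM e expf_card.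
Qed.

Lemma orbP p r : reflect (exists t, r = act p t) (r \in orb p).
Proof.
case: p r => [[x y] z] [[x' y'] z']; rewrite inE /=; apply: (iffP andP) => /=.
  case=> /eqP->; have [->|nz] := eqVneq z 0 => /=.
    case/andP=> /eqP->; have [->|ny] := eqVneq y 0 => /=.
      by move/eqP->; exists (0, 0, 0); rewrite /act /= !mul0r !subr0.
    (* Here z = 0, so a must solve x - y [sigma a] = x'. *)
    have [a ea] := sigma_surj ((x - x') / y); exists (a, 0, 0).
    by rewrite /act /= ea mulrC divfK // !mul0r !subr0 opprB addrC subrK.
  (* For z != 0, a is chosen to correct the second coordinate, and then c to correct the first. *)
  move=> _; pose a := (y - y') / z.
  have divK u : z * (u / z) = u by rewrite mulrC divfK.
  by exists (a, (x - y * sigma a - x') / z, 0); rewrite /act /= !divK !subKr.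
case=> [[[a c] d]]; rewrite /act /= => -[-> -> ->]; rewrite eqxx; split=> //.
have [->|nz] //= := eqVneq z 0; rewrite !mul0r !subr0 eqxx /=.
by have [->|ny] //= := eqVneq y 0; rewrite mul0r subr0.
Qed.

Lemma orb_eq p r : r \in orb p -> orb r = orb p.
Proof.
rewrite inE => /andP[/eqP e2 h]; apply/setP=> s; rewrite !inE e2; congr (_ && _).
case: eqP h => //= _ /andP[/eqP-> h]; congr (_ && _).
by case: eqP h => //= _ /eqP->.
Qed.

Lemma orbit_module_pat p : orbit_module U th (pat p) = span_br (orb p).
Proof.
rewrite -[LHS]genmx_sums_genmx -[RHS]genmx_sums_genmx; apply/genmxP/andP; split.
  apply/sumsmx_subP=> u /ree_sylP[t ->].
  rewrite GLval_elt (pattern_act_pat cardF) (sumsmx_sup (act p t)) //.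
  by apply/orbP; exists t.
apply/sumsmx_subP=> r /orbP[t ->]; rewrite (sumsmx_sup (elt t)) ?elt_in //.
by rewrite GLval_elt (pattern_act_pat cardF).
Qed.


(** * Elements acting by scalars, and separation by verges *)

Lemma orb_module p : mxmodule rU (span_br (orb p)).
Proof.
apply/mxmoduleP=> u /ree_sylP[s ->]; rewrite /span_br sumsmxMr.
apply/sumsmx_subP=> r or_p; apply: submx_trans (submxMr _ (_ : <<br r>> <= br r)%MS) _.
  by rewrite genmxE.
rewrite br_mul scalemx_sub // (sumsmx_sup (act r s)) ?genmxE //.
by rewrite -(orb_eq or_p); apply/orbP; exists s.
Qed.

Lemma span_br_scalar (S : {set T}) s (c : C) :
  (forall p, p \in S -> act p s = p /\ th (dot p (Ycoord s)) = c) ->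
  span_br S *m rU (elt s) = c *: span_br S.
Proof.
move=> hS; apply/eigenspaceP/sumsmx_subP=> p Sp; rewrite genmxE.
by have [ep ec] := hS p Sp; apply/eigenspaceP; rewrite br_mul ep ec.
Qed.

Lemma orb_scalar4 p d :
  span_br (orb p) *m rU (elt (0, 0, d)) = th (p.2 * - d) *: span_br (orb p).
Proof.
have s0 : sigma (0 : F) = 0 by rewrite expr0n addn_eq0 expn_eq0.
apply: span_br_scalar => [[[x y] z]]; rewrite inE => /andP[/eqP<- _].
rewrite /act /dot /= s0; split; first by congr (_, _, _); ring.
by congr th; ring.
Qed.

Lemma orb_scalar3 p c d : p.2 = 0 ->
  span_br (orb p) *m rU (elt (0, c, d)) = th (p.1.2 * - c) *: span_br (orb p).
Proof.
have s0 : sigma (0 : F) = 0 by rewrite expr0n addn_eq0 expn_eq0.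
move=> p0; apply: span_br_scalar => [[[x y] z]].
rewrite inE p0 eqxx /= => /andP[/eqP-> /andP[/eqP-> _]].
rewrite /act /dot /= s0; split; first by congr (_, _, _); ring.
by congr th; ring.
Qed.

Lemma orb_scalar1 p a : p.2 = 0 -> p.1.2 = 0 ->
  span_br (orb p) *m rU (elt (a, 0, 0)) = th (p.1.1 * a) *: span_br (orb p).
Proof.
move=> p0 p1; apply: span_br_scalar => [[[x y] z]].
rewrite inE p0 p1 !eqxx /= => /andP[/eqP-> /andP[/eqP-> /eqP->]].
rewrite /act /dot /=; split; first by congr (_, _, _); ring.
by congr th; ring.
Qed.

Lemma orb_hom_trivial p r : verge (pat p) <> verge (pat r) ->
  hom_trivial rU (span_br (orb p)) (span_br (orb r)).
Proof.
rewrite !verge_pat => ne.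
have [e2|n2] := eqVneq p.2 r.2; last first.
  have [t nt] := th_separates n2.
  by apply: hom_trivial_scalar (elt_in (0, 0, - t)) (orb_scalar4 _ _)
    (orb_scalar4 _ _) _; rewrite opprK.
(* Equal nonzero last entries would give equal verges, so both are 0; the same argument then applies
   to the middle entries. *)
rewrite e2 in ne; case: eqP ne => //= r0 ne; rewrite r0 in e2.
have [e1|n1] := eqVneq p.1.2 r.1.2; last first.
  have [t nt] := th_separates n1.
  by apply: hom_trivial_scalar (elt_in (0, - t, 0)) (orb_scalar3 _ _ _)
    (orb_scalar3 _ _ _) _; rewrite ?opprK.
rewrite e1 in ne; case: eqP ne => //= r1 ne; rewrite r1 in e1.
have [e|n] := eqVneq p.1.1 r.1.1; first by rewrite e in ne.
have [t nt] := th_separates n.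
exact: hom_trivial_scalar (elt_in (t, 0, 0)) (orb_scalar1 _ e2 e1)
    (orb_scalar1 _ r0 r1) nt.
Qed.

(** * Dimensions and reducibility *)

Lemma card_orb4 p : p.2 != 0 -> #|orb p| = (#|F| ^ 2)%N.
Proof.
move=> nz; have -> : orb p = [set (u, p.2) | u in [set: F * F]].
  apply/setP=> [[u z]]; rewrite inE nz andbT /=.
  apply/eqP/imsetP=> [->|[v _]]; [by exists u; rewrite ?inE | by case].
by rewrite card_imset ?cardsT ?card_prod ?expnS ?muln1 // => u v [].
Qed.

Lemma card_orb3 p : p.2 = 0 -> p.1.2 != 0 -> #|orb p| = #|F|.
Proof.
move=> z0 ny; have -> : orb p = [set (x, p.1.2, 0) | x in [set: F]].
  apply/setP=> [[[x y] z]]; rewrite inE z0 eqxx ny andbT /=.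
  apply/andP/imsetP=> [[/eqP-> /eqP->]|[v _ [_ -> ->]]]; last by [].
  by exists x.
by rewrite card_imset ?cardsT // => u v [].
Qed.

Lemma card_orb1 p : p.2 = 0 -> p.1.2 = 0 -> #|orb p| = 1%N.
Proof.
move=> z0 y0; rewrite -(cards1 p); congr #|pred_of_set _|; apply/setP=> [[[x y] z]].
case: p z0 y0 => [[x' y'] z'] /= -> ->.
by rewrite !inE !xpair_eqE /= eqxx /= andbC [(y == 0) && _]andbC.
Qed.

Let cardF_gt1 : (1 < #|F|)%N.
Proof. exact: finNzRing_gt1. Qed.

Let splitU : group_splitting_field C U.
Proof. exact: group_closure_closed_field. Qed.

Lemma orb_not_simple4 p : p.2 != 0 -> ~ mxsimple rU (span_br (orb p)).
Proof.
move=> nz simp; have := mxsimple_rank_sqr (S := fun t => rU (elt t)) splitU simp.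
rewrite rank_span_br card_orb4 // !card_prod -expnM => /(_ _)/wrap[].
  by move=> u /ree_sylP[t ->]; exists t, 1; rewrite scale1r.
(* The bound would read q^4 <= q^3. *)
by rewrite -mulnA -[(_ * (_ * _))%N]/(#|F| ^ 3)%N leq_exp2l.
Qed.

Lemma orb_not_simple3 p : p.2 = 0 -> p.1.2 != 0 -> ~ mxsimple rU (span_br (orb p)).
Proof.
have s0 : sigma (0 : F) = 0 by rewrite expr0n addn_eq0 expn_eq0.
move=> z0 ny simp.
have := mxsimple_rank_sqr (S := fun a => rU (elt (a, 0, 0))) splitU simp.
rewrite rank_span_br card_orb3 // => /(_ _)/wrap[].
  move=> u /ree_sylP[[[a c] d] ->]; exists a, (th (p.1.2 * - c)).
  (* The left factor acts by a scalar, so up to scalars only the q operators Y(a, 0, 0) remain, and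
     the bound would read q^2 <= q. *)
  have -> : elt (a, c, d) = (elt (0%R, c, d + c * a) * elt (a, 0%R, 0%R))%g.
    by rewrite eltM; congr elt; rewrite /Ymul /=; congr (_, _, _); ring.
  by rewrite repr_mxM ?elt_in // mulmxA orb_scalar3 // scalemxAl.
by rewrite -[leqRHS]expn1 leq_exp2l.
Qed.

Lemma orb_simple1 p : p.2 = 0 -> p.1.2 = 0 -> mxsimple rU (span_br (orb p)).
Proof.
by move=> z0 y0; apply: mxsimple_rank1; rewrite ?orb_module // rank_span_br card_orb1.
Qed.

(** [mxnonsimple] asks for an actual proper nonzero submodule; classical logic provides it, the
    module itself being nonzero because p lies in its orbit. *)
Lemma orb_nonsimple p : ~ mxsimple rU (span_br (orb p)) ->
  mxnonsimple rU (span_br (orb p)).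
Proof.
move=> nsim; apply: boolp.contrapT => nns; apply/nsim/mxsimpleP.
split; rewrite ?orb_module // -mxrank_eq0 rank_span_br cards_eq0.
by apply/set0Pn; exists p; rewrite inE !eqxx /= !orbT.
Qed.

(** * Verge patterns and the three families *)

Lemma pat_e12 x : pat (x, 0, 0) = x *: mx_e F 1 2.
Proof. by rewrite /pat !scale0r !addr0. Qed.

Lemma pat_e13 y : pat (0, y, 0) = y *: mx_e F 1 3.
Proof. by rewrite /pat !scale0r addr0 add0r. Qed.

Lemma pat_e14 z : pat (0, 0, z) = z *: mx_e F 1 4.
Proof. by rewrite /pat !scale0r !add0r. Qed.

Lemma orb_verge4 p : p.2 != 0 -> orb p = orb (0, 0, p.2).
Proof. by move=> nz; apply: orb_eq; rewrite inE eqxx /= nz. Qed.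

Lemma orb_verge3 p : p.2 = 0 -> p.1.2 != 0 -> orb p = orb (0, p.1.2, 0).
Proof. by move=> z0 ny; apply: orb_eq; rewrite inE z0 !eqxx /= ny. Qed.

Lemma orb_verge1 p : p.2 = 0 -> p.1.2 = 0 -> p = (p.1.1, 0, 0).
Proof. by case: p => [[x y] z] /= -> ->. Qed.


Definition fam_cond i p : Prop :=
  match i with
  | 4 => p.2 != 0
  | 3 => p.1.2 != 0 /\ p.2 = 0
  | 1 => p.1.2 = 0 /\ p.2 = 0
  | _ => False
  end.

Lemma in_familyP i (M : 'M[C]_#|U|) :
  in_family th i M <-> exists2 p, fam_cond i p & M = span_br (orb p).
Proof.
split=> [[A [/patternsP[p ->] ->]]|[p ci ->]].
  rewrite orbit_module_pat !entry_pat // => ci; exists p => //.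
exists (pat p); split; rewrite ?patterns_pat ?orbit_module_pat //.
by move: ci; rewrite /fam_cond !entry_pat.
Qed.

Lemma family_verge i j p r : fam_cond i p -> fam_cond j r -> i <> j ->
  verge (pat p) <> verge (pat r).
Proof.
(* By antisymmetry an inequality of indices suffices. In the cases k > l to be excluded, the verge
   of q is nonzero, so its column is determined; the possibly zero verges of family 1 occur only on
   the other side. *)
suff sep k l q s : fam_cond k q -> fam_cond l s -> verge (pat q) = verge (pat s) ->
    (k <= l)%N.
  move=> ci cj ne_ij eV; case: ne_ij; apply/eqP.
  by rewrite eqn_leq (sep _ _ _ _ ci cj eV) (sep _ _ _ _ cj ci (esym eV)).
have eZ (a b : F) (j' k' : nat) : (0 < j' <= 8)%N -> (0 < k' <= 8)%N ->
    a *: mx_e F 1 j' = b *: mx_e F 1 k' -> a != 0 -> (j' == k') = true.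
  move=> hj hk /(congr1 (fun A => entry A 1 j')) e nz; move: e.
  have eE (x : F) n : (0 < n <= 8)%N -> entry (x *: mx_e F 1 n) 1 j' = x * (j' == n)%:R.
    by move=> hn; rewrite /entry mxE -[mx_e _ _ _ _ _]/(entry _ 1 j') entry_mx_e.
  rewrite !eE // eqxx mulr1 => e; apply: contraNT nz => /negPf n.
  by rewrite e n mulr0.
rewrite !verge_pat.
case: k => [|[|[|[|[|k]]]]] //; case: l => [|[|[|[|[|l]]]]] //=.
- by move=> [n1 ->] [-> ->]; rewrite eqxx n1 /= => e; have := eZ _ _ 3%N 2%N isT isT e n1.
- by move=> n1 [-> ->]; rewrite eqxx n1 /= => e; have := eZ _ _ 4%N 2%N isT isT e n1.
- by move=> n1 [n2 ->]; rewrite eqxx n1 n2 /= => e; have := eZ _ _ 4%N 3%N isT isT e n1.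
Qed.

End OrbitModules.

Theorem proposition5p5 (R : realType) (m : nat) (F : finFieldType)
    (cardF : #|F| = (3 ^ (2 * m + 1))%N) (th : F -> R[i])
    (th_lin : linear_character th) (th_nontrivial : exists t : F, th t != 1) :
  let q := (3 ^ (2 * m + 1))%N in
  let U := ree_syl cardF in
  let CU := regular_repr R[i] U in
  let V := patterns F in
  let O := @orbit_module R[i] F U th in
  (forall A : 'M[F]_8, A \in V ->
     [\/ exists2 a : F, a != 0 & O A = O (a *: mx_e F 1 4),
         exists2 a : F, a != 0 & O A = O (a *: mx_e F 1 3) |
         exists a : F, O A = O (a *: mx_e F 1 2)])
  /\ [/\ forall M : 'M[R[i]]_#|U|,
           in_family th 4 M <-> (exists2 a : F, a != 0 & M = O (a *: mx_e F 1 4)),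
         forall M : 'M[R[i]]_#|U|,
           in_family th 3 M <-> (exists2 a : F, a != 0 & M = O (a *: mx_e F 1 3)) &
         forall M : 'M[R[i]]_#|U|,
           in_family th 1 M <-> (exists a : F, M = O (a *: mx_e F 1 2))]
  /\ (forall a : F, a != 0 ->
        [/\ verge_pattern (a *: mx_e F 1 4),
            \rank (O (a *: mx_e F 1 4)) = (q ^ 2)%N &
            ~ mxsimple CU (O (a *: mx_e F 1 4))])
  /\ (forall a : F, a != 0 ->
        [/\ verge_pattern (a *: mx_e F 1 3), \rank (O (a *: mx_e F 1 3)) = q &
            ~ mxsimple CU (O (a *: mx_e F 1 3))])
  /\ (forall a : F,
        [/\ verge_pattern (a *: mx_e F 1 2), \rank (O (a *: mx_e F 1 2)) = 1%N &
            mxsimple CU (O (a *: mx_e F 1 2))])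
  /\ (forall A B : 'M[F]_8, A \in V -> B \in V -> verge A <> verge B ->
        hom_trivial CU (O A) (O B))
  /\ (forall (i j : nat) (M N : 'M[R[i]]_#|U|),
        in_family th i M -> in_family th j N -> i <> j -> hom_trivial CU M N)
  /\ (forall M : 'M[R[i]]_#|U|, in_family th 1 M -> mxsimple CU M)
  /\ (forall M N : 'M[R[i]]_#|U|, in_family th 1 M -> in_family th 1 N -> M <> N ->
        orthogonal_modules CU M N)
  /\ (forall M : 'M[R[i]]_#|U|, in_family th 3 M \/ in_family th 4 M -> mxnonsimple CU M).
Proof.
move=> q U CU V O.
have OE p : O (pat p) = span_br cardF th (orb p).
  exact: orbit_module_pat.
clearbody O.
have O4 z : O (z *: mx_e F 1 4) = span_br cardF th (orb (0, 0, z)) by rewrite -OE pat_e14.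
have O3 y : O (y *: mx_e F 1 3) = span_br cardF th (orb (0, y, 0)) by rewrite -OE pat_e13.
have O2 x : O (x *: mx_e F 1 2) = span_br cardF th (orb (x, 0, 0)) by rewrite -OE pat_e12.
have hom A B : A \in V -> B \in V -> verge A <> verge B -> hom_trivial CU (O A) (O B).
  move=> /patternsP[p ->] /patternsP[r ->]; rewrite !OE.
  exact: orb_hom_trivial.
have fam1 M : in_family th 1 M <-> exists a : F, M = O (a *: mx_e F 1 2).
  split=> [/in_familyP[p [y0 z0] ->]|[a ->]].
    by exists p.1.1; rewrite O2 -orb_verge1.
  by apply/in_familyP; exists (a, 0, 0).
have fam3 M : in_family th 3 M <-> exists2 a : F, a != 0 & M = O (a *: mx_e F 1 3).
  split=> [/in_familyP[p [ny z0] ->]|[a nz ->]].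
    by exists p.1.2; rewrite // O3 -orb_verge3.
  by apply/in_familyP; exists (0, a, 0).
have fam4 M : in_family th 4 M <-> exists2 a : F, a != 0 & M = O (a *: mx_e F 1 4).
  split=> [/in_familyP[p nz ->]|[a nz ->]].
    by exists p.2; rewrite // O4 -orb_verge4.
  by apply/in_familyP; exists (0, 0, a).
have vp p : verge (pat p) = pat p -> verge_pattern (pat p).
  by move=> e; split; rewrite ?patterns_pat ?e.
have simple1 a : mxsimple CU (O (a *: mx_e F 1 2)).
  by rewrite O2; apply: orb_simple1.
have not_simple3 a : a != 0 -> ~ mxsimple CU (O (a *: mx_e F 1 3)).
  by move=> na; rewrite O3; apply: orb_not_simple3.
have not_simple4 a : a != 0 -> ~ mxsimple CU (O (a *: mx_e F 1 4)).
  by move=> na; rewrite O4; apply: orb_not_simple4.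
split=> [A /patternsP[p ->]|].
  have [z0|nz] := eqVneq p.2 0; last first.
    by apply: Or31; exists p.2; rewrite // OE O4 -orb_verge4.
  have [y0|ny] := eqVneq p.1.2 0; last first.
    by apply: Or32; exists p.1.2; rewrite // OE O3 -orb_verge3.
  by apply: Or33; exists p.1.1; rewrite OE O2 -orb_verge1.
split; first by split.
split=> [a nz|].
  split; [|by rewrite O4 rank_span_br // card_orb4 // cardF|exact: not_simple4].
  by rewrite -pat_e14; apply: vp; rewrite verge_pat /= nz pat_e14.
split=> [a nz|].
  split; [|by rewrite O3 rank_span_br // card_orb3 // cardF|exact: not_simple3].
  by rewrite -pat_e13; apply: vp; rewrite verge_pat /= eqxx nz pat_e13.
split=> [a|].
  split; [|by rewrite O2 rank_span_br // card_orb1|exact: simple1].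
  by rewrite -pat_e12; apply: vp; rewrite verge_pat /= eqxx pat_e12.
split; first exact: hom.
split=> [i j M N|].
  move=> /in_familyP[p ci ->] /in_familyP[r cj ->] ne_ij.
  by apply: orb_hom_trivial => //; apply: family_verge ci cj ne_ij.
split=> [M /fam1[a ->] //|]; split=> [M N /fam1[a ->] /fam1[b ->] ne_ab|M].
  (* A pattern supported at position (1, 2) is its own verge, so equal verges would give equal
     modules. *)
  have ne_v : verge (a *: mx_e F 1 2) <> verge (b *: mx_e F 1 2).
    rewrite -!pat_e12 !verge_pat /= !eqxx /= => e; case: ne_ab.
    by rewrite e.
  by split; apply: hom; rewrite -?pat_e12 ?patterns_pat ?pat_e12 //; apply/nesym.
have nonsimple p : ~ mxsimple CU (O (pat p)) -> mxnonsimple CU (O (pat p)).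
  by rewrite OE; apply: orb_nonsimple.
case=> [/fam3|/fam4] [a nz ->].
  by rewrite -pat_e13; apply: nonsimple; rewrite pat_e13; apply: not_simple3.
by rewrite -pat_e14; apply: nonsimple; rewrite pat_e14; apply: not_simple4.
Qed.
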